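(* Let $X\in\mathbb{R}^{n\times d}$, $\alpha>0$, and let $p$ be a probability distribution over $\{1,\dots,n\}$ with $p_i>0$ for all $i$. Let $\tilde X$ denote the matrix $X$ with its $i$-th row rescaled by $\frac1{\sqrt{\alpha p_i}}$ for every $i\in\{1,\dots,n\}$. Then for any $r>0$: if $\tilde\sigma\sim\text{R-DPP}_p^r(\tilde X,I)$ and, given $\tilde\sigma$, $S\sim\mathrm{DPP}(\tilde X_{\tilde\sigma})$, then $$\tilde\sigma_S\sim\mathrm{DPP}\Big(\sqrt{\tfrac r\alpha}\,X\Big).$$
   Context: For a matrix $Y$ with $n$ rows and a sequence $\sigma\in\{1,\dots,n\}^k$ (repetitions allowed), $Y_\sigma$ is the $k$-row matrix whose $i$-th row is row $\sigma_i$ of $Y$; for $S\subseteq\{1,\dots,k\}$, $\sigma_S=\{\sigma_i\}_{i\in S}$. $\mathrm{DPP}(Y)$, for a matrix $Y$ with $m$ rows, is the distribution over subsets $S\subseteq\{1,\dots,m\}$ with $\Pr(S)=\det(Y_SY_S^\top)/\det(I+YY^\top)$, where $Y_S$ is the submatrix of rows indexed by $S$ (the empty determinant is $1$). R-DPP: given $Y\in\mathbb{R}^{n\times d}$ with rows $y_j^\top$, a probability distribution $p=(p_1,\dots,p_n)$, a positive semi-definite $A\in\mathbb{R}^{d\times d}$ and $r>0$, $\text{R-DPP}_p^r(Y,A)$ is the distribution over all sequences $\tilde\sigma\in\bigcup_{k=0}^\infty\{1,\dots,n\}^k$ given by $$\Pr(\tilde\sigma)=\frac{\det(A+Y_{\tilde\sigma}^\top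 Y_{\tilde\sigma})}{\det\big(A+r\sum_jp_jy_jy_j^\top\big)}\,\frac{r^ke^{-r}}{k!}\prod_{i=1}^kp_{\tilde\sigma_i}\qquad\text{for }\tilde\sigma\in\{1,\dots,n\}^k.$$ *)

(* Defs.v *)
From HB Require Import structures.
From mathcomp Require Export all_boot all_order all_algebra.
From mathcomp Require Export all_classical all_reals all_analysis.

Set Implicit Arguments.
Unset Strict Implicit.
Unset Printing Implicit Defensive.

Export Order.TTheory GRing.Theory Num.Theory.

Local Open Scope classical_set_scope.
Local Open Scope ring_scope.

Section Submatrices.
Variables (R : Type) (d : nat).

(* Y_sigma: a row index occurring several times in s is repeated. *)
Definition seq_rows (n : nat) (Y : 'M[R]_(n, d)) (s : seq 'I_n) :
    'M[R]_(size s, d) :=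
  rowsub (tnth (in_tuple s)) Y.

(* Y_S: the rows indexed by S, taken in increasing order. *)
Definition set_rows (m : nat) (Y : 'M[R]_(m, d)) (S : {set 'I_m}) :
    'M[R]_(#|S|, d) :=
  rowsub (fun i : 'I_#|S| => enum_val i) Y.

End Submatrices.

(* sigma_S = {sigma_i : i in S}, for a set S of positions in sigma. *)
Definition seq_select (n : nat) (s : seq 'I_n) (S : {set 'I_(size s)}) :
    {set 'I_n} :=
  [set tnth (in_tuple s) i | i in S].

Section MassFunctions.
Variable R : realType.

Definition dpp (m d : nat) (Y : 'M[R]_(m, d)) (S : {set 'I_m}) : R :=
  \det (set_rows Y S *m (set_rows Y S)^T) / \det (1%:M + Y *m Y^T).

(* The row y_j^T is row j Y.  This is a probability mass function when p is a
   probability vector, 0 < r, A is positive semi-definite and the denominator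
   is nonzero. *)
Definition rdpp (n d : nat) (p : 'I_n -> R) (r : R) (Y : 'M[R]_(n, d))
    (A : 'M[R]_d) (s : seq 'I_n) : R :=
  \det (A + (seq_rows Y s)^T *m seq_rows Y s)
    / \det (A + r *: \sum_(j < n) p j *: ((row j Y)^T *m row j Y))
  * (r ^+ size s * expR (- r) / (size s)`!%:R)
  * \prod_(i <- s) p i.

End MassFunctions.

Section Laws.
Context (disp : measure_display) (Omega : measurableType disp) (R : realType).
Variable P : probability Omega R.

(* X ~ f, for X with values in a countable type (so that measurability of X
   amounts to measurability of its fibres) and f a mass function. *)
Definition follows (T : countType) (X : Omega -> T) (f : T -> R) : Prop :=
  forall x, measurable (X @^-1` [set x]) /\ P (X @^-1` [set x]) = (f x)%:E.

(* Given X, Y ~ g X.  The type of values of Y depends on the value of X, so the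
   event {X = x and Y = y} is expressed as an equality of dependent pairs; the
   condition is P(X = x, Y = y) = P(X = x) g_x(y). *)
Definition follows_given (T : countType) (U : T -> countType)
    (X : Omega -> T) (Y : forall w, U (X w)) (g : forall x, U x -> R) : Prop :=
  forall (x : T) (y : U x),
    let E := [set w | Tagged U (Y w) = Tagged U y] in
    measurable E /\ P E = (P (X @^-1` [set x]) * (g x y)%:E)%E.

End Laws.

(* Main.v *)
Require Import Defs.
From mathcomp Require Import perm ring.

(* Write Y for the matrix with rescaled rows, T for a target set and t for its
   cardinal.  By Sylvester's identity the normalization of DPP(Y_sigma) cancels
   the determinant in the R-DPP mass of sigma, so that the joint mass of
   (sigma, S) is a Poisson weight times prod_i p_(sigma_i) times the Gram
   determinant of (Y_sigma)_S.  This Gram determinant vanishes when S contains two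
   positions with the same row, and otherwise it is the one of Y_T, where
   T = sigma_S.  The number of sets S of t positions with sigma_S = T is the
   product over j in T of the multiplicity of j in sigma; its mean over i.i.d.
   samples of size k is k^_t * prod_(j in T) p_j, and averaging k^_t over the
   Poisson distribution gives r^t.  The weights p_j then cancel against the row
   scaling of Y_T. *)

Set Implicit Arguments.
Unset Strict Implicit.
Unset Printing Implicit Defensive.

Import numFieldNormedType.Exports.

Local Open Scope ring_scope.

(** * Determinants of Gram matrices *)

(** Sylvester's identity: one block matrix with unit diagonal blocks factors both as lower times
    upper and as upper times lower triangular. *)
Lemma det_add1_mulmxC (R : comUnitRingType) (m n : nat) (A : 'M[R]_(m, n))
    (B : 'M[R]_(n, m)) : \det (1%:M + A *m B) = \det (1%:M + B *m A).
Proof.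
have e1 : block_mx 1%:M (- A) B 1%:M =
    block_mx 1%:M 0 B 1%:M *m block_mx 1%:M (- A) 0 (1%:M + B *m A).
  by rewrite mulmx_block !mul1mx !mulmx1 !mul0mx ?mulmx0 !addr0 mulmxN addrCA
    addNr addr0.
have e2 : block_mx 1%:M (- A) B 1%:M =
    block_mx (1%:M + A *m B) (- A) 0 1%:M *m block_mx 1%:M 0 B 1%:M.
  by rewrite mulmx_block !mul1mx !mulmx1 ?mul0mx ?mulmx0 !add0r mulNmx addrK.
have := e2; rewrite e1 => /(congr1 determinant).
by rewrite !det_mulmx !det_lblock !det_ublock !det1 !mul1r !mulr1.
Qed.

(** A row vector [v] in the kernel satisfies |v|^2 + |vY|^2 = 0, hence vanishes. *)
Lemma det_add1_gram_neq0 (R : realFieldType) (m d : nat) (Y : 'M[R]_(m, d)) :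
  \det (1%:M + Y *m Y^T) != 0.
Proof.
rewrite -unitfE -unitmxE -row_free_unit; apply: inj_row_free => v hv.
have: (v *m (1%:M + Y *m Y^T) *m v^T) 0 0 = 0 by rewrite hv mul0mx mxE.
rewrite mulmxDr mulmxDl mulmx1 -!mulmxA mulmxA -trmx_mul mxE.
have gram_ge0 k (u : 'rV[R]_k) : 0 <= (u *m u^T) 0 0.
  by rewrite mxE sumr_ge0// => i _; rewrite mxE -expr2 sqr_ge0.
move=> /eqP; rewrite paddr_eq0// => /andP[/eqP + _].
rewrite mxE => /eqP; rewrite psumr_eq0 => [/allP h|i _]; last first.
  by rewrite mxE -expr2 sqr_ge0.
apply/rowP => i; have := h i (mem_index_enum i).
by rewrite !mxE -expr2 sqrf_eq0 => /eqP.
Qed.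

Lemma det_gram_rowsub_noninj (R : comPzRingType) (m n d : nat)
    (Y : 'M[R]_(n, d)) (g : 'I_m -> 'I_n) :
  ~ injective g -> \det (rowsub g Y *m (rowsub g Y)^T) = 0.
Proof.
move=> /injectiveP /injectivePn[i [j ij gij]].
by apply: (determinant_alternate ij) => k; rewrite !mxE; apply: eq_bigr => l _;
  rewrite !mxE gij.
Qed.

(** Two enumerations of the same rows differ by a permutation, whose sign enters the Gram
    determinant squared. *)
Lemma det_gram_rowsub_image (R : comPzRingType) (m m' n d : nat)
    (Y : 'M[R]_(n, d)) (g : 'I_m -> 'I_n) (h : 'I_m' -> 'I_n) :
    injective g -> injective h -> [set g i | i in 'I_m] = [set h i | i in 'I_m'] ->
  \det (rowsub g Y *m (rowsub g Y)^T) = \det (rowsub h Y *m (rowsub h Y)^T).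
Proof.
move=> ginj hinj gh.
have mm' : m = m'.
  by rewrite -(card_ord m) -(card_ord m') -(card_imset _ ginj) gh card_imset.
subst m'.
have /fin_all_exists[e he] (i : 'I_m) : exists j, h j = g i.
  have /imsetP[j _ ->] : g i \in [set h i | i in 'I_m] by rewrite -gh imset_f.
  by exists j.
have einj : injective e by move=> i j eij; apply: ginj; rewrite -!he eij.
have -> : rowsub g Y = row_perm (perm einj) (rowsub h Y).
  by apply/matrixP => i j; rewrite !mxE permE he.
rewrite row_permE trmx_mul mulmxA -(mulmxA (perm_mx _)) !det_mulmx det_tr.
by rewrite det_perm mulrAC -expr2 sqrr_sign mul1r.
Qed.

(** Row scaling is left multiplication by a diagonal matrix. The entrywise form of [Z] matches that
    of the rescaled matrix in the theorem. *)
Lemma det_gram_rowsub_scale (R : comPzRingType) (m n d : nat)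
    (Y : 'M[R]_(n, d)) (c : 'I_n -> R) (g : 'I_m -> 'I_n) :
  let Z := rowsub g (\matrix_(i, j) (c i * Y i j)) in
  \det (Z *m Z^T) = \prod_i (c (g i)) ^+ 2 *
                    \det (rowsub g Y *m (rowsub g Y)^T).
Proof.
move=> Z.
have -> : Z = diag_mx (\row_i c (g i)) *m rowsub g Y.
  by apply/matrixP => i j; rewrite mul_diag_mx !mxE.
rewrite trmx_mul tr_diag_mx mulmxA -(mulmxA (diag_mx _)) !det_mulmx det_diag.
rewrite mulrAC prodrXl expr2; congr (_ * _ * _).
all: by apply: eq_bigr => i _; rewrite mxE.
Qed.

(** * Counting position sets and averaging over i.i.d. samples *)

Lemma card_transversals (A B : finType) (f : A -> B) (T : {set B}) :
  #|[set Y : {set A} | (f @: Y == T) && (#|Y| == #|T|)]|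
  = (\prod_(j in T) #|[set a | f a == j]|)%N.
Proof.
(* Both sides count the sections of f over T; Y is the image of a section. *)
pose G := [set g : {ffun 'I_#|T| -> A} | [forall i, f (g i) == enum_val i]].
transitivity #|G|; last first.
  rewrite cardsE -[LHS]/#|[pred g | _]|.
  have -> : #|[pred g : {ffun 'I_#|T| -> A} | [forall i, f (g i) == enum_val i]]|
      = #|family (fun i : 'I_#|T| => [set a | f a == enum_val i])|.
    apply: eq_card => g; rewrite !inE; apply/forallP/familyP => h i.
      by rewrite inE.
    by have := h i; rewrite inE.
  rewrite card_family foldrE big_map big_enum/=.
  by rewrite [RHS]big_enum_val.
have fg g i : g \in G -> f (g i) = enum_val i by rewrite inE => /forallP/(_ i)/eqP.
have ginj g : g \in G -> injective g.
  by move=> gG i j gij; apply: enum_val_inj; rewrite -!(fg g)// gij.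
rewrite -(@card_in_imset _ _ (fun g : {ffun 'I_#|T| -> A} => g @: 'I_#|T|) G).
  apply: eq_card => Y; rewrite inE; apply/andP/imsetP.
    move=> [/eqP fY /eqP cY].
    have finj : {in Y &, injective f} by apply/imset_injP; rewrite fY cY.
    have /fin_all_exists[g hg] (i : 'I_#|T|) : exists a, a \in Y /\ f a = enum_val i.
      have /imsetP[a aY e] : enum_val i \in f @: Y by rewrite fY enum_valP.
      by exists a.
    have gG : finfun g \in G.
      by rewrite inE; apply/forallP => i; rewrite ffunE; apply/eqP; case: (hg i).
    exists (finfun g) => //; apply/esym/eqP; rewrite eqEcard; apply/andP; split.
      by apply/fintype.subsetP => a /imsetP[i _ ->]; rewrite ffunE; case: (hg i).
    by rewrite card_imset ?card_ord ?cY//; exact: ginj.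
  move=> [g gG ->]; split; last by rewrite card_imset ?card_ord//; exact: ginj.
  apply/eqP/setP => j; rewrite -imset_comp; apply/imsetP/idP => [[i _ ->]|jT].
    by rewrite /= fg// enum_valP.
  by exists (enum_rank_in jT j) => //=; rewrite fg// enum_rankK_in.
(* A section is determined by its image: [g i] equals some [h j], and applying [f] gives [j = i]. *)
move=> g h gG hG gh; apply/ffunP => i.
have : g i \in h @: 'I_#|T| by rewrite -gh imset_f.
move=> /imsetP[j _ gij]; rewrite gij; congr (h _).
by apply: enum_val_inj; rewrite -(fg _ j hG) -(fg _ i gG) gij.
Qed.

Lemma big_tupleS (R : Type) (idx : R) (op : Monoid.com_law idx) (T : finType)
    (k : nat) (F : seq T -> R) :
  \big[op/idx]_(t : k.+1.-tuple T) F t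
  = \big[op/idx]_(x : T) \big[op/idx]_(t : k.-tuple T) F (x :: t).
Proof.
rewrite pair_bigA/= (reindex (fun u : T * k.-tuple T => [tuple of u.1 :: u.2]))//.
exists (fun t : k.+1.-tuple T => (thead t, [tuple of behead t])) => [[x t] _|t _].
  by congr pair; apply: val_inj.
by rewrite /= [RHS]tuple_eta; apply: val_inj.
Qed.

(* Expected number of ways to pick, in an i.i.d. sample of size k, one position
   carrying each element of T. *)
Lemma sum_tuple_prod_count (R : comPzRingType) (I : finType) (p : I -> R)
    (p_sum1 : \sum_i p i = 1) (k : nat) (T : {set I}) :
  \sum_(t : k.-tuple I) (\prod_(i <- t) p i) * \prod_(j in T) (count_mem j t)%:R
  = (k ^_ #|T|)%:R * \prod_(j in T) p j.
Proof.
elim: k T => [|k IH] T.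
  rewrite (big_pred1 [tuple]) => [|t]; last by rewrite [t]tuple0; apply/esym/eqP.
  rewrite big_nil mul1r /=; have [->|[j jT]] := set_0Vmem T.
    by rewrite !big_set0 cards0 mulr1.
  by rewrite (bigD1 j)//= mul0r (cardsD1 j) jT ffactE/= mul0r.
rewrite (big_tupleS _ k (fun t => (\prod_(i <- t) p i) *
  \prod_(j in T) (count_mem j t)%:R)).
(* Prepending [x] raises only the factor at [x], from c to c + 1; expanding the product separates
   the samples whose first position is picked. *)
have step x (t : seq I) : \prod_(j in T) (count_mem j (x :: t))%:R
    = \prod_(j in T) (count_mem j t)%:R
      + (x \in T)%:R * \prod_(j in T :\ x) (count_mem j t)%:R :> R.
  case: (boolP (x \in T)) => xT; last first.
    rewrite mul0r addr0; apply: eq_bigr => j jT /=.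
    by case: eqP => [xj|//]; rewrite xj jT in xT.
  rewrite mul1r (big_setD1 x)//= [in RHS](big_setD1 x)//= eqxx natrD mulrDl mul1r.
  rewrite addrC; congr (_ * _ + _); apply: eq_bigr => j; rewrite !inE => /andP[jx _];
    by rewrite eq_sym (negbTE jx).
under eq_bigr => x _.
  under eq_bigr => t _ do rewrite step big_cons mulrDr -!mulrA
    [X in _ + _ * X]mulrCA.
  rewrite big_split/= -!mulr_sumr IH IH; over.
rewrite big_split/= -mulr_suml p_sum1 mul1r.
have -> : \sum_x p x * ((x \in T)%:R *
      ((k ^_ #|T :\ x|)%:R * \prod_(j in T :\ x) p j))
    = \sum_(x in T) (k ^_ #|T|.-1)%:R * \prod_(j in T) p j.
  rewrite [RHS]big_mkcond; apply: eq_bigr => x _.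
  case: ifP => xT; last by rewrite mul0r mulr0.
  rewrite mul1r mulrCA (big_setD1 x xT)/=; congr (_%:R * _).
  by rewrite (cardsD1 x T) xT.
rewrite sumr_const -mulrnAl -mulrDl -mulrnA -natrD; congr (_%:R * _).
(* What remains is the Pascal-type recurrence for falling factorials. The case [k < m] is apart
   because [k - m] is truncated; there [k ^_ m] is 0. *)
case: #|T| => [|m]; first by rewrite muln0 addn0 !ffactn0.
rewrite ffactSS ffactnSr /= -mulnDr mulnC; have [km|mk] := ltnP k m.
  by rewrite ffact_small// !muln0.
by rewrite addnS subnK.
Qed.

(** * Joint mass of a sequence and a position set *)

Lemma set_rows_seq_rows (R : Type) (n d : nat) (Z : 'M[R]_(n, d))
    (s : seq 'I_n) (Y : {set 'I_(size s)}) :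
  set_rows (seq_rows Z s) Y =
  rowsub (fun i : 'I_#|Y| => tnth (in_tuple s) (enum_val i)) Z.
Proof. by apply/matrixP => i j; rewrite !mxE. Qed.

Lemma imset_enum_val (T U : finType) (A : {set T}) (f : T -> U) :
  [set f (enum_val i) | i in 'I_#|A|] = f @: A.
Proof.
apply/setP => x; apply/imsetP/imsetP => [[i _ ->]|[a aA ->]].
  by exists (enum_val i) => //; exact: enum_valP.
by exists (enum_rank_in aA a) => //; rewrite enum_rankK_in.
Qed.

(** The cardinals agree exactly when the positions in [Y] carry distinct values; otherwise [W] has
    two equal rows. *)
Lemma det_gram_seq_select (R : comPzRingType) (n d : nat) (Z : 'M[R]_(n, d))
    (s : seq 'I_n) (Y : {set 'I_(size s)}) :
  let W := set_rows (seq_rows Z s) Y in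
  let V := set_rows Z (seq_select Y) in
  \det (W *m W^T) = if #|Y| == #|seq_select Y| then \det (V *m V^T) else 0.
Proof.
rewrite /= set_rows_seq_rows; set g := fun i : 'I_#|Y| => _.
have gY : [set g i | i in 'I_#|Y|] = seq_select Y by rewrite imset_enum_val.
case: ifP => cY.
  apply: det_gram_rowsub_image; last 1 first.
  - by rewrite gY (imset_enum_val _ id) imset_id.
  - have /imset_injP ginj : #|g @: 'I_#|Y| | == #|'I_#|Y| | by rewrite gY card_ord eq_sym.
    by move=> i j; apply: ginj.
  - exact: enum_val_inj.
apply: det_gram_rowsub_noninj => ginj.
by rewrite -gY card_imset// card_ord eqxx in cY.
Qed.

Lemma card_tnth_count (T : eqType) (s : seq T) (x : T) :
  #|[set i | tnth (in_tuple s) i == x]| = count_mem x s.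
Proof.
by rewrite -sum1_count big_tnth -sum1_card; apply: eq_bigl => i; rewrite inE.
Qed.

Lemma sum_rdpp_dpp (R : realType) (n d : nat) (Z : 'M[R]_(n, d)) (p : 'I_n -> R)
    (r : R) (s : seq 'I_n) (T : {set 'I_n}) :
  \sum_(Y : {set 'I_(size s)} | seq_select Y == T)
    rdpp p r Z 1%:M s * dpp (seq_rows Z s) Y
  = \det (set_rows Z T *m (set_rows Z T)^T)
    / \det (1%:M + r *: \sum_(j < n) p j *: ((row j Z)^T *m row j Z))
    * (r ^+ size s * expR (- r) / (size s)`!%:R)
    * ((\prod_(i <- s) p i) * \prod_(j in T) (count_mem j s)%:R).
Proof.
rewrite -mulr_sumr.
have -> : \sum_(Y : {set 'I_(size s)} | seq_select Y == T) dpp (seq_rows Z s) Y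
    = \prod_(j in T) (count_mem j s)%:R
      * \det (set_rows Z T *m (set_rows Z T)^T)
      / \det (1%:M + seq_rows Z s *m (seq_rows Z s)^T).
  rewrite -mulr_suml; congr (_ / _).
  transitivity (\sum_(Y : {set 'I_(size s)} | (seq_select Y == T) && (#|Y| == #|T|))
      \det (set_rows Z T *m (set_rows Z T)^T)).
    rewrite big_mkcondr; apply: eq_bigr => Y /eqP YT.
    by rewrite det_gram_seq_select YT.
  rewrite sumr_const -[LHS]mulr_natl; congr (_ * _).
  rewrite -cardsE card_transversals natr_prod.
  by apply: eq_bigr => j _; rewrite card_tnth_count.
(* Sylvester's identity turns the numerator of [rdpp] into the denominator of [dpp]. With the other
   inverses abstracted, [field] only needs this determinant to be nonzero. *)
rewrite /rdpp det_add1_mulmxC.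
move: (det_add1_gram_neq0 (seq_rows Z s)).
move: (\det (1%:M + r *: _))^-1 (_%:R^-1) => D k d0.
by field.
Qed.

(** * Factorial moments of the Poisson distribution *)

(** The terms with [k < t] vanish and (k + t)^_t / (k + t)! = 1 / k!, so shifting by [t] leaves r^t
    times the exponential series. *)
Lemma cvg_sum_exp_ffact (R : realType) (r : R) (t : nat) :
  (\sum_(0 <= k < N) (r ^+ k / k`!%:R * (k ^_ t)%:R) @[N --> \oo]
    --> r ^+ t * expR r)%classic.
Proof.
have shiftE : (fun N => \sum_(0 <= k < N + t) (r ^+ k / k`!%:R * (k ^_ t)%:R))
    = (fun=> r ^+ t) \* series (exp_coeff r).
  apply/funext => N; rewrite (@big_cat_nat _ _ _ t)//= ?leq_addl//.
  rewrite [X in X + _]big1_seq ?add0r; last first.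
    by move=> k; rewrite mem_index_iota => /= kt; rewrite ffact_small// mulr0.
  rewrite -{1}[t]add0n big_addn addnK seriesEnat/= mulr_sumr.
  apply: eq_bigr => k _; rewrite -(ffact_fact (leq_addl k t)) addnK natrM exprD.
  have kt : ((k + t) ^_ t)%:R != 0 :> R by rewrite pnatr_eq0 -lt0n ffact_gt0 leq_addl.
  have k0 : k`!%:R != 0 :> R by rewrite pnatr_eq0 -lt0n fact_gt0.
  by rewrite /exp_coeff /=; field; rewrite kt k0.
have := cvgM (cvg_cst (r ^+ t)) (is_cvg_series_exp_coeff r).
by rewrite -shiftE => lim; rewrite -(cvg_shiftn t); exact: lim.
Qed.

(** * Decomposition of the event by the length of the sequence *)

Lemma measure_fintype_bigcup (disp : measure_display) (Omega : measurableType disp)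
    (R : realType) (P : {measure set Omega -> \bar R}) (I : finType)
    (D : {pred I}) (E : I -> set Omega) :
    (forall i, measurable (E i)) -> trivIset setT E ->
  P (\bigcup_(i in [set` D]) E i)%classic = (\sum_(i in D) P (E i))%E.
Proof.
move=> mE tE; rewrite measure_fin_bigcup//; last exact: sub_trivIset tE.
rewrite (fsbigE (enum D)) ?enum_uniq//.
- rewrite big_enum_cond/=; apply: eq_bigl => i; case: (boolP (i \in D)) => //= iD.
  by rewrite mem_set.
- by move=> i /=; rewrite mem_enum.
- by move=> i /= iD; rewrite mem_enum iD.
Qed.

(** Fixing the length makes the type of pairs finite; injectivity into pairs over sequences makes
    the events of distinct pairs disjoint. *)
Lemma seq_pair_inj (n k : nat) :
  injective (fun u : {t : k.-tuple 'I_n & {set 'I_(size t)}} =>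
    Tagged (fun s : seq 'I_n => {set 'I_(size s)}) (tagged u)).
Proof.
move=> [t A] [t' A'] /= e.
have tt' : t = t' by apply: val_inj; exact: (congr1 tag e).
subst t'; congr existT; apply/eqP.
by move/eqP: e; rewrite eq_Tagged.
Qed.

Theorem theorem8 (R : realType) (n d : nat) (X : 'M[R]_(n, d)) (alpha : R)
  (p : 'I_n -> R) (r : R)
  (alpha_gt0 : 0 < alpha)
  (p_gt0 : forall i, 0 < p i) (p_sum1 : \sum_(i < n) p i = 1)
  (r_gt0 : 0 < r)
  (disp : measure_display) (Omega : measurableType disp)
  (P : probability Omega R)
  (sigma : Omega -> seq 'I_n)
  (S : forall w : Omega, {set 'I_(size (sigma w))}) :
  let Xt : 'M[R]_(n, d) :=
    \matrix_(i < n, j < d) (1 / Num.sqrt (alpha * p i) * X i j) in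
  follows P sigma (rdpp p r Xt 1%:M) ->
  @follows_given _ Omega R P (seq 'I_n) (fun s => {set 'I_(size s)})
    sigma S (fun s => dpp (seq_rows Xt s)) ->
  follows P (fun w => seq_select (S w)) (dpp (Num.sqrt (r / alpha) *: X)).
Proof.
move=> Xt sigmaP SP T.
pose tagS w := Tagged (fun s : seq 'I_n => {set 'I_(size s)}) (S w).
pose I k := {t : k.-tuple 'I_n & {set 'I_(size t)}}.
pose E k (u : I k) := [set w | tagS w =
  Tagged (fun s : seq 'I_n => {set 'I_(size s)}) (tagged u)]%classic.
pose D k := [pred u : I k | seq_select (tagged u) == T].
(* [F k] is the event that the sequence has length [k] and selects [T], a finite union of events of
   known probability. *)
pose F k := (\bigcup_(u in [set` D k]) E k u)%classic.
have mE k u : measurable (E k u) by case: (SP (tag u) (tagged u)).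
have PE k u : P (E k u) =
    (rdpp p r Xt 1%:M (tag u) * dpp (seq_rows Xt (tag u)) (tagged u))%:E.
  have [_ ->] := SP (tag u) (tagged u).
  by have [_ ->] := sigmaP (tag u).
have tE k : trivIset setT (E k).
  by move=> u v _ _ [w [wu wv]]; apply: seq_pair_inj; rewrite -wu -wv.
have mF k : measurable (F k).
  by apply: fin_bigcup_measurable => // ; exact: finite_finpred.
have sizeF k w : F k w -> size (sigma w) = k.
  move=> [u _ wu]; have -> : sigma w = tag u by exact: (congr1 tag wu).
  exact: size_tuple.
have tF : trivIset setT F.
  by move=> k l _ _ [w [/sizeF <- /sizeF <-]].
have selF : ((fun w => seq_select (S w)) @^-1` [set T] = \bigcup_k F k)%classic.
  apply/seteqP; split => w /=.
    move=> wT; exists (size (sigma w)) => //.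
    exists (existT _ (in_tuple (sigma w)) (S w)) => //=.
    exact/eqP.
  by move=> [k _ [u /eqP <-]] /(congr1 (fun v => seq_select (tagged v))).
have mU : measurable (\bigcup_k F k)%classic by exact: bigcup_measurable.
rewrite selF; split=> //.
(* [K] gathers the factors of the probability of [F k] that do not depend on [k]. *)
pose K := \det (set_rows Xt T *m (set_rows Xt T)^T)
    / \det (1%:M + r *: \sum_(j < n) p j *: ((row j Xt)^T *m row j Xt))
    * expR (- r) * \prod_(j in T) p j.
have PF k : P (F k) = (K * (r ^+ k / k`!%:R * (k ^_ #|T|)%:R))%:E.
  rewrite measure_fintype_bigcup//; last exact: tE.
  rewrite (eq_bigr _ (fun u _ => PE k u)).
  rewrite sumEFin; congr EFin.
  rewrite -(sig_big_dep xpredT (fun (t : k.-tuple 'I_n) Y => seq_select Y == T)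
    (fun t Y => rdpp p r Xt 1%:M t * dpp (seq_rows Xt t) Y))/=.
  under eq_bigr do rewrite sum_rdpp_dpp size_tuple.
  rewrite -mulr_sumr sum_tuple_prod_count// /K.
  move: (\det _)^-1 (_%:R^-1) => a b.
  ring.
have sumPF N : (\sum_(0 <= k < N) P (F k))%E =
    (K * \sum_(0 <= k < N) (r ^+ k / k`!%:R * (k ^_ #|T|)%:R))%:E.
  by rewrite mulr_sumr -sumEFin; apply: eq_bigr => k _; rewrite PF.
have lim : (\sum_(0 <= k < N) P (F k) @[N --> \oo]
    --> (K * (r ^+ #|T| * expR r))%:E)%classic.
  apply: cvg_EFin; first by apply: nearW => N; rewrite sumPF.
  have h := cvgM (cvg_cst K) (@cvg_sum_exp_ffact _ r #|T|).
  apply: (cvg_trans _ (h _ _)); apply: near_eq_cvg; apply: nearW => N.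
  by rewrite /= sumPF.
(* By countable additivity the same partial sums tend to the probability of the union. *)
rewrite (cvg_unique _ (measure_semi_sigma_additive F mF tF mU) lim)//.
congr EFin.
have c2 i : (1 / Num.sqrt (alpha * p i)) ^+ 2 = (alpha * p i)^-1.
  by rewrite div1r exprVn sqr_sqrtr// mulr_ge0// ltW.
set s := Num.sqrt (r / alpha).
have s2 : s ^+ 2 = r / alpha.
  by rewrite sqr_sqrtr// divr_ge0// ltW.
have a0 : alpha != 0 by rewrite gt_eqF.
have p0 i : p i != 0 by rewrite gt_eqF.
have gramXt : \det (set_rows Xt T *m (set_rows Xt T)^T)
    = \prod_(j in T) (alpha * p j)^-1 * \det (set_rows X T *m (set_rows X T)^T).
  rewrite [LHS]det_gram_rowsub_scale [in RHS]big_enum_val.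
  by congr (_ * _); apply: eq_bigr => i _; rewrite c2.
have gramsX : \det (set_rows (s *: X) T *m (set_rows (s *: X) T)^T)
    = \prod_(j in T) (r / alpha) * \det (set_rows X T *m (set_rows X T)^T).
  have -> : s *: X = \matrix_(i, j) (s * X i j) by apply/matrixP => i j; rewrite !mxE.
  rewrite [LHS](det_gram_rowsub_scale _ (fun=> s)) [in RHS]big_enum_val.
  by congr (_ * _); apply: eq_bigr => i _; rewrite s2.
(* The weight p_k cancels the squared scaling 1 / (alpha p_k) of row k, leaving r / alpha, so the
   normalizations agree up to Sylvester's identity. *)
have secondMoment : r *: (\sum_(j < n) p j *: ((row j Xt)^T *m row j Xt))
    = (s *: X)^T *m (s *: X).
  apply/matrixP => i j; rewrite !mxE summxE mulr_sumr; apply: eq_bigr => k _.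
  rewrite !mxE big_ord1 !mxE mulrACA -expr2 c2 mulrACA -expr2 s2.
  by field; rewrite a0 p0.
rewrite /dpp /K secondMoment gramXt gramsX det_add1_mulmxC expRN.
(* The r^t of the Poisson average supplies one factor r for each element of [T]. *)
have -> : \prod_(j in T) (r / alpha)
    = r ^+ #|T| * (\prod_(j in T) (alpha * p j)^-1 * \prod_(j in T) p j).
  rewrite -prodr_const -!big_split/=; apply: eq_bigr => j _.
  by field; rewrite a0 p0.
move: (\det (1%:M + _))^-1 => D'.
by field; rewrite gt_eqF// expR_gt0.
Qed.
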